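(* Let $P:=\{x\in\mathbb{R}^n : Ax\le b\}$, where $A$ is an $m\times n$ totally unimodular matrix and $b\in\mathbb{Z}^m$. Then $P\in\mathcal{P}$, i.e. for any $k\in\mathbb{Z}_{\geq 0}$, any $r\in\{0,\ldots,k\}$ and any $w\in\mathbb{Z}^n$, the intersection $rP\cap(w-(k-r)P)$ is box-integer. In particular, every projection of $P$ has the Integer Carathéodory Property.
   Context: A matrix $A$ is totally unimodular if every square submatrix $C$ of $A$ satisfies $\det(C)\in\{-1,0,1\}$. $\mathcal{P}$ denotes the set of rational polyhedra $P\subseteq\mathbb{R}^n$ (for some $n$) satisfying the condition spelled out in the claim. For a real number $t\ge 0$ and $P\subseteq\mathbb{R}^n$, $tP=\{tx: x\in P\}$, and $w-tP=\{w-tx: x\in P\}$. Inequalities between vectors are componentwise. Let $\bar{\mathbb{Z}}=\mathbb{Z}\cup\{-\infty,+\infty\}$. A polyhedron is called an integer polyhedron if each of its (nonempty) faces contains an integer point (in particular the empty polyhedron is an integer polyhedron). A polyhedron $Q\subseteq\mathbb{R}^n$ is box-integer if for every pair of vectors $c\le d$ in $\bar{\mathbb{Z}}^n$, the set $\{x\in Q: c\le x\le d\}$ is an integer polyhedron. A projection of $P\subseteq\mathbb{R}^n$ means the image of $P$ under the coordinate projection onto some subset of the coordinates (including $P$ itself). A polyhedron $Q\subseteq\mathbb{R}^d$ has the Integer Carathéodory Property (ICP) if for every positive integer $k$ and every integer vector $w\in kQ$ there exist affinely independent $x_1,\ldots,x_t\in Q\cap\mathbb{Z}^d$ and $n_1,\ldots,n_t\in\mathbb{Z}_{\ge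 0}$ such that $n_1+\cdots+n_t=k$ and $w=\sum_{i} n_i x_i$. *)

(* Defs.v *)
From HB Require Import structures.
From mathcomp Require Import all_boot all_order all_algebra.
From mathcomp Require Import boolp classical_sets reals constructive_ereal.

Set Implicit Arguments.
Unset Strict Implicit.
Unset Printing Implicit Defensive.

Import Order.TTheory GRing.Theory Num.Theory.

Local Open Scope classical_set_scope.
Local Open Scope ring_scope.

(* Strictly increasing maps 'I_k -> 'I_n enumerate the k-element subsets of    *)
(* 'I_n; they select the rows and columns of a submatrix, and the coordinates *)
(* kept by a coordinate projection.                                           *)
Definition increasing (k n : nat) (f : 'I_k -> 'I_n) : Prop :=
  forall i j : 'I_k, (i < j)%N -> (f i < f j)%N.

Definition totally_unimodular (R : comNzRingType) (m n : nat)
    (A : 'M[R]_(m, n)) : Prop :=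
  forall (k : nat) (f : 'I_k -> 'I_m) (g : 'I_k -> 'I_n),
    increasing f -> increasing g -> \det (mxsub f g A) \in [:: -1; 0; 1].

Section Polyhedra.
Variable R : realType.

Definition polyhedron (m n : nat) (A : 'M[R]_(m, n)) (b : 'cV[R]_m) :
    set 'cV[R]_n :=
  [set x | forall i, (A *m x) i 0 <= b i 0].

Definition is_polyhedron (n : nat) (Q : set 'cV[R]_n) : Prop :=
  exists (m : nat) (A : 'M[R]_(m, n)) (b : 'cV[R]_m), Q = polyhedron A b.

Definition is_rational_polyhedron (n : nat) (Q : set 'cV[R]_n) : Prop :=
  exists (m : nat) (A : 'M[rat]_(m, n)) (b : 'cV[rat]_m),
    Q = polyhedron (map_mx ratr A) (map_mx ratr b).

Definition dilate (n : nat) (t : R) (Q : set 'cV[R]_n) : set 'cV[R]_n :=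
  [set t *: x | x in Q].

(* w - tQ *)
Definition reflect_dilate (n : nat) (w : 'cV[R]_n) (t : R)
    (Q : set 'cV[R]_n) : set 'cV[R]_n :=
  [set w - t *: x | x in Q].

Definition integer_vector (n : nat) (x : 'cV[R]_n) : Prop :=
  forall i, x i 0 \is a Num.int.

(* The set where a valid inequality c x <= delta is tight. Taking c = 0 and   *)
(* delta = 0 shows that Q is a face of itself.                                *)
Definition is_face (n : nat) (Q F : set 'cV[R]_n) : Prop :=
  exists (c : 'rV[R]_n) (delta : R),
    (forall x, Q x -> (c *m x) 0 0 <= delta) /\
    F = [set x | Q x /\ (c *m x) 0 0 = delta].

Definition integer_polyhedron (n : nat) (Q : set 'cV[R]_n) : Prop :=
  is_polyhedron Q /\
  forall F : set 'cV[R]_n, is_face Q F -> F !=set0 ->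
    exists2 x, F x & integer_vector x.

Definition box (n : nat) (c d : 'I_n -> \bar int) : set 'cV[R]_n :=
  [set x : 'cV[R]_n | forall i,
    (er_map intr (c i) <= (x i 0)%:E)%E /\
    ((x i 0)%:E <= er_map intr (d i))%E].

Definition box_integer (n : nat) (Q : set 'cV[R]_n) : Prop :=
  forall c d : 'I_n -> \bar int, (forall i, (c i <= d i)%E) ->
    integer_polyhedron (Q `&` box c d).

(* The class of polyhedra denoted by a calligraphic P. *)
Definition in_calP (n : nat) (P : set 'cV[R]_n) : Prop :=
  is_rational_polyhedron P /\
  forall (k r : nat) (w : 'cV[R]_n), (r <= k)%N -> integer_vector w ->
    box_integer (dilate r%:R P `&` reflect_dilate w (k - r)%:R P).

Definition projection (n d : nat) (f : 'I_d -> 'I_n) (P : set 'cV[R]_n) :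
    set 'cV[R]_d :=
  [set rowsub f x | x in P].

Definition affinely_independent (d t : nat) (x : 'I_t -> 'cV[R]_d) : Prop :=
  forall a : 'I_t -> R,
    \sum_i a i = 0 -> \sum_i a i *: x i = 0 -> forall i, a i = 0.

Definition ICP (d : nat) (Q : set 'cV[R]_d) : Prop :=
  forall (k : nat) (w : 'cV[R]_d),
    (0 < k)%N -> integer_vector w -> dilate k%:R Q w ->
    exists (t : nat) (x : 'I_t -> 'cV[R]_d) (c : 'I_t -> nat),
      [/\ affinely_independent x,
          forall i, Q (x i) /\ integer_vector (x i),
          (\sum_i c i)%N = k &
          w = \sum_i (c i)%:R *: x i].

End Polyhedra.

(* Main.v *)
Require Import Defs.
From HB Require Import structures.
From mathcomp Require Import all_boot all_order all_algebra perm.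
From mathcomp Require Import boolp classical_sets reals constructive_ereal.
From mathcomp Require Import ring lra zify.

Set Implicit Arguments.
Unset Strict Implicit.
Unset Printing Implicit Defensive.

Import Order.TTheory GRing.Theory Num.Theory.

Local Open Scope classical_set_scope.
Local Open Scope ring_scope.

(* Appending unit rows to A keeps every minor in {-1, 0, 1}.  Both
   rP /\ (w - (k - r)P) and its intersections with boxes are then cut out by
   integer lower and upper bounds on the rows of the extended matrix N, and
   every nonempty face of such a set contains an integer point by Cramer's rule.

   For the Caratheodory property, let W be an integer point of kP and round the
   values of N (W / k) down and up to get a slab around W / k in which every row
   takes at most two consecutive integer values at integer points.  Subtract an
   integer point x of the slab from W until a new row becomes tight at the value
   which x does not take, and induct on k: the remaining points satisfy this row
   with equality and x does not, so affine independence is automatic.  For a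
   projection, lift w to an integer point W whose minimal face in kP meets the
   fibre of w in a single point; the projection is then injective on the affine
   hull of that face. *)

(** * Minors of totally unimodular matrices and of their extensions *)

(* Unlike in [totally_unimodular], rows and columns may be repeated and taken
   in any order. *)
Definition unimodular_minors (R : comNzRingType) (m n : nat)
    (A : 'M[R]_(m, n)) : Prop :=
  forall (k : nat) (f : 'I_k -> 'I_m) (g : 'I_k -> 'I_n),
    \det (mxsub f g A) \in [:: -1; 0; 1].

Lemma sign3P (R : comNzRingType) (x : R) :
  reflect [\/ x = -1, x = 0 | x = 1] (x \in [:: -1; 0; 1]).
Proof.
rewrite !inE; apply: (iffP or3P) => -[/eqP ? | /eqP ? | /eqP ?];
  by [constructor 1 | constructor 2 | constructor 3].
Qed.

Lemma sign3M (R : comNzRingType) (x y : R) :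
  x \in [:: -1; 0; 1] -> y \in [:: -1; 0; 1] -> x * y \in [:: -1; 0; 1].
Proof.
by move=> /sign3P[]-> /sign3P[]->;
  rewrite ?mulrN1 ?mulN1r ?mul1r ?mulr0 ?mul0r ?oppr0 ?opprK !inE eqxx ?orbT.
Qed.

Lemma sign3_sign (R : comNzRingType) (k : nat) :
  (-1 : R) ^+ k \in [:: -1; 0; 1].
Proof. by rewrite -signr_odd; case: odd; rewrite !inE eqxx ?orbT. Qed.

Lemma sort_injection (k n : nat) (f : 'I_k -> 'I_n) : injective f ->
  exists s : {perm 'I_k}, increasing (f \o s).
Proof.
move=> f_inj; pose t := [tuple of map (val \o f) (ord_tuple k)].
have [s ts] : exists s : {perm 'I_k}, sort leq t = [tuple tnth t (s i) | i < k].
  by apply/tuple_permP; rewrite perm_sort.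
exists s => i j ij.
have: sorted ltn (sort leq t).
  rewrite ltn_sorted_uniq_leq sort_uniq (sort_sorted leq_total) andbT.
  by rewrite map_inj_uniq ?enum_uniq// => x y /val_inj/f_inj.
rewrite ts => /(sorted_ltn_nth ltn_trans 0%N) /(_ i j).
rewrite !inE size_tuple => /(_ (ltn_ord i) (ltn_ord j) ij).
by rewrite -!tnth_nth !tnth_mktuple.
Qed.

(** A repeated index gives two equal rows or columns, hence determinant 0; otherwise sorting both
    selections changes the determinant only by the signs of two permutations. *)
Lemma totally_unimodular_minors (R : comNzRingType) (m n : nat)
    (A : 'M[R]_(m, n)) : totally_unimodular A -> unimodular_minors A.
Proof.
move=> tuA k f g.
have [/injectiveP f_inj|/injectivePn[i [j ij fij]]] := boolP (injectiveb f); last first.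
  rewrite (determinant_alternate ij) ?inE ?eqxx ?orbT// => l.
  by rewrite !mxE fij.
have [/injectiveP g_inj|/injectivePn[i [j ij gij]]] := boolP (injectiveb g); last first.
  rewrite -det_tr (determinant_alternate ij) ?inE ?eqxx ?orbT// => l.
  by rewrite !mxE gij.
have [s fs] := sort_injection f_inj; have [u gu] := sort_injection g_inj.
have -> : mxsub f g A =
    row_perm (s^-1)%g (col_perm (u^-1)%g (mxsub (f \o s) (g \o u) A)).
  by apply/matrixP => i j; rewrite !mxE /= !permKV.
by rewrite row_permE col_permE !det_mulmx !det_perm; do 2?apply: sign3M;
  rewrite ?sign3_sign ?tuA.
Qed.

(** Each minor is a diagonal determinant times a minor of [A]. As [h] may repeat rows and [s] may
    negate or erase them, this serves both to stack lower and upper bounds and to discard loose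
    rows. *)
Lemma unimodular_minors_scale (R : comNzRingType) (m n p : nat)
    (A : 'M[R]_(m, n)) (h : 'I_p -> 'I_m) (s : 'I_p -> R) :
  unimodular_minors A -> (forall i, s i \in [:: -1; 0; 1]) ->
  unimodular_minors (\matrix_(i, j) (s i * A (h i) j)).
Proof.
move=> tuA sP k f g.
have -> : mxsub f g (\matrix_(i, j) (s i * A (h i) j)) =
    diag_mx (\row_i s (f i)) *m mxsub (h \o f) g A.
  by rewrite mul_diag_mx; apply/matrixP => i j; rewrite !mxE.
rewrite det_mulmx det_diag sign3M ?tuA//.
elim/big_ind: _ => [||i _]; [exact: (sign3_sign R 0)|exact: sign3M|].
by rewrite mxE.
Qed.

(** Induction on the size of the minor, expanding along a row taken from the identity block; without
    such a row it is a minor of [A]. *)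
Lemma unimodular_minors_col1 (R : comNzRingType) (m n : nat)
    (A : 'M[R]_(m, n)) :
  unimodular_minors A -> unimodular_minors (col_mx A 1%:M).
Proof.
move=> tuA; elim=> [|k IHk] f g; first by rewrite det_mx00 !inE eqxx !orbT.
have [/existsP[i /existsP[l fil]]|] :=
  boolP [exists i, exists l : 'I_n, f i == rshift m l].
(* Once the columns are distinct, the identity row has at most one nonzero entry, so at most one
   term of the expansion survives. *)
- have [/injectiveP g_inj|/injectivePn[j1 [j2 j12 gj]]] := boolP (injectiveb g); last first.
    rewrite -det_tr (determinant_alternate j12) ?inE ?eqxx ?orbT// => j.
    by rewrite !mxE gj.
  have entry j : mxsub f g (col_mx A 1%:M) i j = (l == g j)%:R.
    by rewrite mxE (eqP fil) col_mxEd mxE.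
  rewrite (expand_det_row _ i).
  have [/existsP[j /eqP gj]|/existsPn no] := boolP [exists j, l == g j].
    rewrite (bigD1 j)//= big1 ?addr0; last first.
      move=> j' j'j; rewrite entry gj.
      by rewrite (inj_eq g_inj) eq_sym (negPf j'j) mul0r.
    rewrite entry gj eqxx mul1r sign3M ?sign3_sign//.
    have -> : row' i (col' j (mxsub f g (col_mx A 1%:M))) =
        mxsub (f \o lift i) (g \o lift j) (col_mx A 1%:M).
      by apply/matrixP => i' j'; rewrite !mxE.
    exact: IHk.
  by rewrite big1 ?inE ?eqxx ?orbT// => j _; rewrite entry (negPf (no j)) mul0r.
- move=> /existsPn no; have fA i : exists l : 'I_m, f i == lshift n l.
    case: (split_ordP (f i)) => l fl; first by exists l; rewrite fl.
    by have /existsPn/(_ l) := no i; rewrite fl eqxx.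
  have -> : mxsub f g (col_mx A 1%:M) = mxsub (fun i => xchoose (fA i)) g A.
    apply/matrixP => i j; rewrite mxE [RHS]mxE.
    by rewrite {1}(eqP (xchooseP (fA i))) col_mxEu.
  exact: tuA.
Qed.

(** * Integer solutions of unimodular linear systems *)

Lemma sign3_int (R : realType) (x : R) :
  x \in [:: -1; 0; 1] -> x \is a Num.int.
Proof. by move=> /sign3P[]->; rewrite ?rpredN ?rpred0 ?rpred1. Qed.

Lemma unimodular_minors_int (R : realType) (m n : nat) (A : 'M[R]_(m, n)) :
  unimodular_minors A -> forall i j, A i j \is a Num.int.
Proof.
move=> tuA i j; apply: sign3_int.
have := tuA 1 (fun=> i) (fun=> j).
by rewrite det_mx11 mxE.
Qed.

Lemma det_int (R : realType) (n : nat) (A : 'M[R]_n) :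
  (forall i j, A i j \is a Num.int) -> \det A \is a Num.int.
Proof.
move=> Aint; apply: rpred_sum => s _; rewrite rpredMsign.
by apply: rpred_prod => i _.
Qed.

Lemma mulmx_int (R : realType) (m n p : nat) (A : 'M[R]_(m, n))
    (B : 'M[R]_(n, p)) :
  (forall i j, A i j \is a Num.int) -> (forall i j, B i j \is a Num.int) ->
  forall i j, (A *m B) i j \is a Num.int.
Proof.
by move=> Aint Bint i j; rewrite mxE rpred_sum// => l _; rewrite rpredM.
Qed.

(** Cramer's rule: the cofactors are integers, and the determinant, being invertible, is 1 or -1. *)
Lemma invmx_unimodular_int (R : realType) (n : nat) (A : 'M[R]_n) :
  unimodular_minors A -> A \in unitmx ->
  forall i j, invmx A i j \is a Num.int.
Proof.
move=> tuA Aunit i j; rewrite /invmx Aunit mxE rpredM//.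
  apply: sign3_int; move: Aunit (tuA n id id); rewrite mxsub_id unitmxE.
  move=> unitA /sign3P[] detA; rewrite detA ?invrN1 ?invr1 ?inE ?eqxx ?orbT//.
  by rewrite detA unitr0 in unitA.
rewrite mxE /cofactor rpredMsign det_int// => k l; rewrite !mxE.
exact: unimodular_minors_int.
Qed.

(** A maximal independent set of rows and as many independent columns give a submatrix [S] with
    integer inverse. Solving in these columns, with zeros elsewhere, satisfies the chosen rows,
    hence all rows, which are combinations of them. *)
Lemma integer_solution (R : realType) (m n : nat) (A : 'M[R]_(m, n))
    (y : 'cV[R]_n) :
  unimodular_minors A -> integer_vector (A *m y) ->
  exists2 z : 'cV[R]_n, integer_vector z & A *m z = A *m y.
Proof.
move=> tuA Ay.
pose f := maxrankfun A; pose A1 := rowsub f A.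
have A1_full : row_full A1^T.
  by rewrite /row_full mxrank_tr; exact: maxrowsub_free.
pose g := fullrankfun A1_full; pose S := mxsub f g A.
have SE : S = colsub g A1 by apply/matrixP => i j; rewrite !mxE.
have S_unit : S \in unitmx.
  rewrite -unitmx_tr; have -> : S^T = rowsub g A1^T.
    by apply/matrixP => i j; rewrite !mxE.
  exact: fullrowsub_unit.
have tuS : unimodular_minors S.
  move=> k f' g'; have -> : mxsub f' g' S = mxsub (f \o f') (g \o g') A.
    by apply/matrixP => i j; rewrite !mxE.
  exact: tuA.
have [D AE] : exists D, A = D *m A1.
  by apply/submxP; rewrite eq_maxrowsub.
pose E : 'M[R]_(n, \rank A) := colsub g 1%:M.
have AE' : A *m E = D *m S.
  by rewrite mulmx_colsub mulmx1 SE mulmx_colsub -AE.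
exists (E *m (invmx S *m rowsub f (A *m y))).
  move=> i; apply: mulmx_int => [i' j|i' j].
    by rewrite !mxE natr_int.
  apply: mulmx_int => {}i' {}j; first exact: invmx_unimodular_int.
  by rewrite mxE ord1.
by rewrite mulmxA AE' -mulmxA mulKVmx// -mul_rowsub_mx mulmxA -AE.
Qed.

(** * Integer points on faces *)

(* Moving along the kernel of the tight rows until no further row can become
   tight. *)
Lemma exists_maximally_tight (R : realType) (m n : nat) (A : 'M[R]_(m, n))
    (b : 'cV[R]_m) (x : 'cV[R]_n) : polyhedron A b x ->
  exists y : 'cV[R]_n, [/\ polyhedron A b y,
    forall i, (A *m x) i 0 = b i 0 -> (A *m y) i 0 = b i 0 &
    forall u : 'cV[R]_n,
      (forall i, (A *m y) i 0 = b i 0 -> (A *m u) i 0 = 0) -> A *m u = 0].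
Proof.
pose loose (x : 'cV[R]_n) := [set i | (A *m x) i 0 != b i 0]%SET.
have [k] := ubnP #|loose x|; elim: k x => // k IHk x; rewrite ltnS => xk Px.
have [gen|] := pselect (forall u : 'cV[R]_n,
    (forall i, (A *m x) i 0 = b i 0 -> (A *m u) i 0 = 0) -> A *m u = 0).
  by exists x.
move=> /existsNP[u0 /not_implyP[u0x Au0]].
have [u [ux [j0 uj0]]] : exists u : 'cV[R]_n,
    (forall i, (A *m x) i 0 = b i 0 -> (A *m u) i 0 = 0) /\
    exists j, 0 < (A *m u) j 0.
  have /existsNP[j /eqP] : ~ forall j, (A *m u0) j 0 = 0.
    by move=> h; apply: Au0; apply/matrixP => i j; rewrite ord1 h mxE.
  case: ltgtP => // j0 _; last by exists u0; split=> //; exists j.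
  exists (- u0); split=> [i /u0x u0i|].
    by rewrite mulmxN mxE u0i oppr0.
  by exists j; rewrite mulmxN mxE oppr_gt0.
(* Ratio test: [ratio i] is the step along [u] at which row [i] becomes tight. The smallest one
   keeps [y] feasible and makes row [j] tight, which was loose at [x] because [u] does not vanish on
   it. *)
pose ratio i := (b i 0 - (A *m x) i 0) / (A *m u) i 0.
case: (@arg_minP _ _ _ j0 (fun i => 0 < (A *m u) i 0) ratio uj0) => j uj jmin.
pose y := x + ratio j *: u.
have AyE i : (A *m y) i 0 = (A *m x) i 0 + ratio j * (A *m u) i 0.
  by rewrite mulmxDr -scalemxAr !mxE.
have ratio_ge0 : 0 <= ratio j by rewrite divr_ge0 ?subr_ge0 ?(ltW uj)//; exact: Px.
have Py : polyhedron A b y.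
  move=> i; rewrite AyE; have [ui|ui] := ltP 0 ((A *m u) i 0).
    have := jmin _ ui; rewrite {2}/ratio ler_pdivlMr//; lra.
  by have := Px i; have := mulr_ge0_le0 ratio_ge0 ui; lra.
have xy i : (A *m x) i 0 = b i 0 -> (A *m y) i 0 = b i 0.
  by move=> xi; rewrite AyE (ux _ xi) mulr0 addr0.
have yj : (A *m y) j 0 = b j 0.
  by rewrite AyE /ratio divfK ?gt_eqF// addrC subrK.
have /IHk/(_ Py)[z [Pz yz gen]] : (#|loose y| < k)%N.
  apply: leq_trans xk; apply: proper_card; apply/properP; split.
    by apply/fintype.subsetP => i; rewrite !inE; apply: contra => /eqP/xy->.
  exists j; rewrite !inE ?yj ?eqxx//; apply/eqP => /ux uj0'.
  by rewrite uj0' ltxx in uj.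
by exists z; split=> // i /xy/yz.
Qed.

(** [B] keeps the rows of [A] tight at the maximally tight point [y] and erases the others, so
    [B *m y] is integer and an integer [z] has the same image. The tight rows vanish on [z - y], so
    by maximality [A *m z = A *m y]. *)
Lemma exists_integer_maximally_tight (R : realType) (m n : nat)
    (A : 'M[R]_(m, n)) (b : 'cV[R]_m) (x : 'cV[R]_n) :
  unimodular_minors A -> integer_vector b -> polyhedron A b x ->
  exists z : 'cV[R]_n, [/\ integer_vector z, polyhedron A b z,
    forall i, (A *m x) i 0 = b i 0 -> (A *m z) i 0 = b i 0 &
    forall u : 'cV[R]_n,
      (forall i, (A *m z) i 0 = b i 0 -> (A *m u) i 0 = 0) -> A *m u = 0].
Proof.
move=> tuA bint /exists_maximally_tight[y [Py xy gen]].
pose s i : R := ((A *m y) i 0 == b i 0)%:R.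
pose B := \matrix_(i, j) (s i * A i j).
have BE (v : 'cV[R]_n) i : (B *m v) i 0 = s i * (A *m v) i 0.
  by rewrite !mxE big_distrr/=; apply: eq_bigr => j _; rewrite mxE mulrA.
have tuB : unimodular_minors B.
  apply: (@unimodular_minors_scale _ _ _ _ _ id) => // i.
  by rewrite /s; case: eqP => _; rewrite !inE eqxx ?orbT.
have By : integer_vector (B *m y).
  by move=> i; rewrite BE /s; case: eqP => [->|_]; rewrite ?mul1r ?mul0r ?rpred0.
have [z zint Bz] := integer_solution tuB By.
have Az : A *m z = A *m y.
  apply/eqP; rewrite -subr_eq0 -mulmxBr; apply/eqP; apply: gen => i yi.
  have : (B *m (z - y)) i 0 = 0 by rewrite mulmxBr Bz subrr mxE.
  by rewrite BE /s yi eqxx mul1r.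
by exists z; split=> // [i|i /xy|u]; rewrite Az//; exact: gen.
Qed.

(* A point of a face extends slightly beyond itself, away from a point at which
   the same constraints are tight; so the latter lies on the face as well. *)
Lemma face_tight (R : realType) (m n : nat) (A : 'M[R]_(m, n)) (b : 'cV[R]_m)
    (F : set 'cV[R]_n) (x z : 'cV[R]_n) :
  is_face (polyhedron A b) F -> F x -> polyhedron A b z ->
  (forall i, (A *m x) i 0 = b i 0 -> (A *m z) i 0 = b i 0) -> F z.
Proof.
move=> [c [delta [valid ->]]] [Px xF] Pz xz; split=> //.
apply/eqP; rewrite eq_le valid//=.
have stepE p (M : 'M[R]_(p, n)) e i :
    (M *m (x - e *: (z - x))) i 0 = (M *m x) i 0 - e * (M *m (z - x)) i 0.
  by rewrite mulmxBr -scalemxAr !mxE.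
have [e e0 Pe] : exists2 e : R, 0 < e & polyhedron A b (x - e *: (z - x)).
  (* Each loose row allows a step of its gap over its rate of change; the added 1 keeps the
     denominator positive, and the default 1 covers the absence of loose rows. *)
  pose e0 : R := \big[Num.min/1]_(i | (A *m x) i 0 < b i 0)
    ((b i 0 - (A *m x) i 0) / (1 + `|(A *m (z - x)) i 0|)).
  have pos i : 0 < 1 + `|(A *m (z - x)) i 0|.
    by rewrite ltr_pwDl.
  exists e0.
    apply: lt_bigmin => // i xi; rewrite divr_gt0 ?subr_gt0//.
  move=> i; rewrite stepE.
  have [xi|xi] := ltP ((A *m x) i 0) (b i 0).
    have e0i : e0 <= (b i 0 - (A *m x) i 0) / (1 + `|(A *m (z - x)) i 0|).
      exact: bigmin_le_cond.
    have e0_ge0 : 0 <= e0.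
      apply/ltW/lt_bigmin => // j xj; rewrite divr_gt0 ?subr_gt0//.
    rewrite ler_pdivlMr// mulrDr mulr1 in e0i.
    have : - (A *m (z - x)) i 0 <= `|(A *m (z - x)) i 0|.
      by rewrite -normrN ler_norm.
    move=> /(ler_wpM2l e0_ge0); lra.
  have {xi} xi : (A *m x) i 0 = b i 0 by apply/eqP; rewrite eq_le xi andbT; exact: Px.
  have -> : (A *m (z - x)) i 0 = (A *m z) i 0 - (A *m x) i 0.
    by rewrite mulmxBr !mxE.
  by rewrite xi xz// subrr mulr0 subr0.
(* At the shifted point [c] takes the value [delta - e * (c z - delta)]; its validity forces
   [c z >= delta]. *)
have := valid _ Pe; rewrite stepE xF gerBl pmulr_rge0//.
have -> : (c *m (z - x)) 0 0 = (c *m z) 0 0 - (c *m x) 0 0.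
  by rewrite mulmxBr !mxE.
by rewrite xF subr_ge0.
Qed.

Lemma integer_polyhedron_unimodular (R : realType) (m n : nat)
    (A : 'M[R]_(m, n)) (b : 'cV[R]_m) :
  unimodular_minors A -> integer_vector b ->
  integer_polyhedron (polyhedron A b).
Proof.
move=> tuA bint; split; first by exists m, A, b.
move=> F faceF [x Fx].
have Px : polyhedron A b x by case: faceF Fx => c [delta [_ ->]] [].
have [z [zint Pz xz _]] := exists_integer_maximally_tight tuA bint Px.
by exists z => //; exact: face_tight faceF Fx Pz xz.
Qed.

(** * Slabs as polyhedra *)

Local Open Scope ereal_scope.

Definition slab (R : realType) (m n : nat) (N : 'M[R]_(m, n))
    (c d : 'I_m -> \bar int) : set 'cV[R]_n :=
  [set x | forall i, er_map intr (c i) <= ((N *m x) i ord0)%:E /\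
    ((N *m x) i ord0)%:E <= er_map intr (d i)].

Local Close Scope ereal_scope.

(* The constraint [t <= e], for an extended integer [e], is
   [bound_coef e * t <= bound_rhs e]: trivial for [+oo], absurd for [-oo]. *)
Definition bound_coef (R : realType) (e : \bar int) : R :=
  if e is EFin _ then 1 else 0.

Definition bound_rhs (R : realType) (e : \bar int) : R :=
  match e with EFin z => z%:~R | EPInf => 0 | ENInf => -1 end.

Lemma le_bound (R : realType) (t : R) (e : \bar int) :
  (bound_coef R e * t <= bound_rhs R e) = (t%:E <= er_map intr e)%E.
Proof.
case: e => [z||]; rewrite /= ?mul1r ?mul0r ?lee_fin ?lexx ?leey ?leeNy_eq//.
by rewrite oppr_ge0 ler10.
Qed.

Lemma ge_bound (R : realType) (t : R) (e : \bar int) :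
  (- bound_coef R e * t <= bound_rhs R (- e)%E) = (er_map intr e <= t%:E)%E.
Proof.
case: e => [z||]; rewrite /= ?mulN1r ?oppr0 ?mul0r ?lee_fin ?lexx ?leNye//.
  by rewrite mulrNz lerN2.
by rewrite oppr_ge0 ler10 leye_eq.
Qed.

(** The first [m] rows carry the upper bounds, the last [m] the lower bounds with signs reversed. *)
Definition slab_coef (R : realType) (m : nat) (c d : 'I_m -> \bar int)
    (i : 'I_(m + m)) : R :=
  match split i with
  | inl i => bound_coef R (d i)
  | inr i => - bound_coef R (c i)
  end.

Definition slab_row (m : nat) (i : 'I_(m + m)) : 'I_m :=
  match split i with inl i => i | inr i => i end.

Definition slab_mx (R : realType) (m n : nat) (N : 'M[R]_(m, n))
    (c d : 'I_m -> \bar int) : 'M[R]_(m + m, n) :=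
  \matrix_(i, j) (slab_coef R c d i * N (slab_row i) j).

Definition slab_rhs (R : realType) (m : nat) (c d : 'I_m -> \bar int) :
    'cV[R]_(m + m) :=
  \col_i match split i with
         | inl i => bound_rhs R (d i)
         | inr i => bound_rhs R (- c i)%E
         end.

Lemma slab_mx_upper (R : realType) (m n : nat) (N : 'M[R]_(m, n))
    (c d : 'I_m -> \bar int) (x : 'cV[R]_n) (i : 'I_m) :
  (slab_mx N c d *m x) (lshift m i) 0 = bound_coef R (d i) * (N *m x) i 0.
Proof.
rewrite mxE [in RHS]mxE big_distrr/=; apply: eq_bigr => j _.
by rewrite mxE /slab_coef /slab_row (unsplitK (inl i)) mulrA.
Qed.

Lemma slab_mx_lower (R : realType) (m n : nat) (N : 'M[R]_(m, n))
    (c d : 'I_m -> \bar int) (x : 'cV[R]_n) (i : 'I_m) :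
  (slab_mx N c d *m x) (rshift m i) 0 = - bound_coef R (c i) * (N *m x) i 0.
Proof.
rewrite mxE [in RHS]mxE big_distrr/=; apply: eq_bigr => j _.
by rewrite mxE /slab_coef /slab_row (unsplitK (inr i)) mulrA.
Qed.

Lemma slab_rhs_upper (R : realType) (m : nat) (c d : 'I_m -> \bar int) i :
  slab_rhs R c d (lshift m i) 0 = bound_rhs R (d i).
Proof. by rewrite mxE (unsplitK (inl i)). Qed.

Lemma slab_rhs_lower (R : realType) (m : nat) (c d : 'I_m -> \bar int) i :
  slab_rhs R c d (rshift m i) 0 = bound_rhs R (- c i)%E.
Proof. by rewrite mxE (unsplitK (inr i)). Qed.

Lemma slab_polyhedron (R : realType) (m n : nat) (N : 'M[R]_(m, n))
    (c d : 'I_m -> \bar int) :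
  slab N c d = polyhedron (slab_mx N c d) (slab_rhs R c d).
Proof.
apply/seteqP; split => x Px i.
  case: (split_ordP i) => j ->; have [lo up] := Px j.
    by rewrite slab_mx_upper slab_rhs_upper le_bound.
  by rewrite slab_mx_lower slab_rhs_lower ge_bound.
split.
  by have := Px (rshift m i); rewrite slab_mx_lower slab_rhs_lower ge_bound.
by have := Px (lshift m i); rewrite slab_mx_upper slab_rhs_upper le_bound.
Qed.

Lemma unimodular_minors_slab (R : realType) (m n : nat) (N : 'M[R]_(m, n))
    (c d : 'I_m -> \bar int) :
  unimodular_minors N -> unimodular_minors (slab_mx N c d).
Proof.
move=> tuN; apply: unimodular_minors_scale => // i.
by rewrite /slab_coef; case: (split i) => j;
  [case: (d j) | case: (c j)] => //=; rewrite ?oppr0 !inE eqxx ?orbT.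
Qed.

Lemma slab_rhs_int (R : realType) (m : nat) (c d : 'I_m -> \bar int) :
  integer_vector (slab_rhs R c d).
Proof.
by move=> i; rewrite mxE; case: (split i) => j; [case: (d j) | case: (c j)];
  rewrite /= ?rpredN ?intr_int ?rpred0 ?rpred1.
Qed.

Lemma integer_polyhedron_slab (R : realType) (m n : nat) (N : 'M[R]_(m, n))
    (c d : 'I_m -> \bar int) :
  unimodular_minors N -> integer_polyhedron (slab N c d).
Proof.
move=> tuN; rewrite slab_polyhedron; apply: integer_polyhedron_unimodular.
  exact: unimodular_minors_slab.
exact: slab_rhs_int.
Qed.

(** Maximal tightness restated for a slab. Infinite bounds become zero rows, which say nothing about
    [u]; hence the finite upper bound in the last clause. *)
Lemma exists_integer_slab_tight (R : realType) (m n : nat) (N : 'M[R]_(m, n))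
    (c d : 'I_m -> \bar int) (x : 'cV[R]_n) :
  unimodular_minors N -> slab N c d x ->
  exists z : 'cV[R]_n, [/\ integer_vector z, slab N c d z,
    forall i b, c i = b%:E \/ d i = b%:E ->
      (N *m x) i 0 = b%:~R -> (N *m z) i 0 = b%:~R &
    forall u : 'cV[R]_n,
      (forall i b, c i = b%:E \/ d i = b%:E ->
        (N *m z) i 0 = b%:~R -> (N *m u) i 0 = 0) ->
      forall i b, d i = b%:E -> (N *m u) i 0 = 0].
Proof.
move=> tuN; rewrite slab_polyhedron => Px.
have [z [zint Pz xz gen]] := exists_integer_maximally_tight
  (unimodular_minors_slab c d tuN) (slab_rhs_int R c d) Px.
exists z; split=> // [i b [cb|db] xb|u ub i b db].
- have := xz (rshift m i).
  rewrite !slab_mx_lower slab_rhs_lower cb /= xb !mulN1r mulrNz => /(_ erefl).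
  exact: oppr_inj.
- have := xz (lshift m i).
  by rewrite !slab_mx_upper slab_rhs_upper db /= xb !mul1r => /(_ erefl).
suff /gen/matrixP/(_ (lshift m i) 0) : forall i,
    (slab_mx N c d *m z) i 0 = slab_rhs R c d i 0 -> (slab_mx N c d *m u) i 0 = 0.
  by rewrite slab_mx_upper db mul1r [RHS]mxE.
move=> k; case: (split_ordP k) => j ->.
  rewrite !slab_mx_upper slab_rhs_upper.
  case dj: (d j) => [b'||] /=; rewrite ?mul0r ?mul1r//.
  by apply: (ub _ _ _); right.
rewrite !slab_mx_lower slab_rhs_lower.
case cj: (c j) => [b'||] /=; rewrite ?oppr0 ?mul0r ?mulN1r// mulrNz => /oppr_inj zj.
by rewrite (ub _ b') ?oppr0//; left.
Qed.

(** * Integer Caratheodory decompositions in unit slabs *)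

(** The hyperplane [r = e] contains every [x j] but not [x0], so applying [r] to an affine relation
    forces the coefficient of [x0] to vanish. *)
Lemma affinely_independent_recl (R : realType) (d t : nat)
    (x0 : 'cV[R]_d) (x : 'I_t -> 'cV[R]_d) (r : 'rV[R]_d) (e : R) :
  affinely_independent x -> (forall j, (r *m x j) 0 0 = e) ->
  (r *m x0) 0 0 != e ->
  affinely_independent (fun j : 'I_t.+1 => oapp x x0 (unlift ord0 j)).
Proof.
move=> indep xe x0e a; rewrite !big_ord_recl unlift_none /=.
under [in X in _ -> X -> _]eq_bigr do rewrite liftK /=.
set S := \sum_(i < t) _ => a_sum ax_sum.
have a0 : a ord0 = 0.
  have : (r *m (a ord0 *: x0 + \sum_(i < t) a (lift ord0 i) *: x i)) 0 0 = 0.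
    by rewrite ax_sum mulmx0 mxE.
  rewrite mulmxDr mulmx_sumr mxE summxE -scalemxAr mxE.
  under eq_bigr do rewrite -scalemxAr mxE xe.
  rewrite -mulr_suml -/S => h; apply/eqP.
  have : a ord0 * ((r *m x0) 0 0 - e) = 0 by move: h; rewrite (_ : S = - a ord0); [lra|lra].
  by move=> /eqP; rewrite mulf_eq0 (subr_eq0 _ e) (negPf x0e) orbF.
rewrite a0 add0r in a_sum; rewrite a0 scale0r add0r in ax_sum.
move=> i; have [j ->|->//] := unliftP ord0 i.
exact: (indep (a \o lift ord0)).
Qed.

(* [W] is a point of the [k]-th dilate of the slab [beta - 1 <= N x <= beta].
   An integer point [x] of the minimal face containing [W / k] takes the value
   [beta i] or [beta i - 1] on row [i].  Subtracting [x] from [W] as often as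
   possible, one reaches a multiple of the slab on whose face some row takes
   the opposite value; so [x] is affinely independent of that face. *)
Lemma slab_caratheodory (R : realType) (q n k : nat) (N : 'M[R]_(q, n))
    (beta : 'I_q -> int) (W : 'cV[R]_n) :
  unimodular_minors N -> (forall u : 'cV[R]_n, N *m u = 0 -> u = 0) ->
  integer_vector W ->
  (forall i, k%:R * (beta i - 1)%:~R <= (N *m W) i 0 <= k%:R * (beta i)%:~R) ->
  exists (t : nat) (x : 'I_t -> 'cV[R]_n) (c : 'I_t -> nat),
    [/\ affinely_independent x,
      forall j, integer_vector (x j) /\
        forall i, [/\ (beta i - 1)%:~R <= (N *m x j) i 0 <= (beta i)%:~R,
          (N *m W) i 0 = k%:R * (beta i)%:~R ->
            (N *m x j) i 0 = (beta i)%:~R &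
          (N *m W) i 0 = k%:R * (beta i - 1)%:~R ->
            (N *m x j) i 0 = (beta i - 1)%:~R],
      (\sum_j c j)%N = k & W = \sum_j (c j)%:R *: x j].
Proof.
move=> tuN injN; have [l] := ubnP k; elim: l => // l IHl in k W *.
rewrite ltnS => kl Wint Wk.
have [k0|k_gt0] := posnP k.
  exists 0%N, (fun=> 0), (fun=> 0%N); split; rewrite ?big_ord0//.
  - by move=> a _ _ [].
  - by case.
  apply: injN; apply/matrixP => i j; rewrite ord1 [RHS]mxE.
  by apply/eqP; rewrite eq_le andbC; have := Wk i; rewrite k0 !mul0r.
have kR_gt0 : 0 < k%:R :> R by rewrite ltr0n.
pose y := k%:R^-1 *: W.
have NyE i : (N *m y) i 0 = (N *m W) i 0 / k%:R.
  by rewrite -scalemxAr mxE mulrC.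
have Ny i b : (N *m W) i 0 = k%:R * b -> (N *m y) i 0 = b.
  by rewrite NyE => ->; rewrite mulrC mulKf ?gt_eqF.
have /(exists_integer_slab_tight tuN)[x [xint xslab xtight _]] :
    slab N (fun i => (beta i - 1)%:E) (fun i => (beta i)%:E) y.
  move=> i; rewrite /= !lee_fin NyE ler_pdivlMr// ler_pdivrMr//.
  by rewrite ![_ * k%:R]mulrC; have /andP[] := Wk i.
have {}xslab i : (beta i - 1)%:~R <= (N *m x) i 0 <= (beta i)%:~R.
  by apply/andP; have := xslab i; rewrite /= !lee_fin.
have xup i : (N *m W) i 0 = k%:R * (beta i)%:~R -> (N *m x) i 0 = (beta i)%:~R.
  by move=> /Ny; apply: xtight; right.
have xlo i : (N *m W) i 0 = k%:R * (beta i - 1)%:~R ->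
    (N *m x) i 0 = (beta i - 1)%:~R.
  by move=> /Ny; apply: xtight; left.
have Nint : forall i j, N i j \is a Num.int := unimodular_minors_int tuN.
have NVint (V : 'cV[R]_n) i : integer_vector V -> (N *m V) i 0 \is a Num.int.
  by move=> Vint; apply: mulmx_int => // ? ?; rewrite ord1.
have x01 i : (N *m x) i 0 = (beta i)%:~R \/ (N *m x) i 0 = (beta i - 1)%:~R.
  have /intrP[z zE] := NVint _ i xint; have := xslab i; rewrite zE !ler_int.
  move=> ?; have [->|->] : z = beta i \/ z = beta i - 1 by lia.
    by left.
  by right.
pose up i := (N *m x) i 0 == (beta i)%:~R.
(* How many copies of [x] can leave [W], with [k] dropping by one each time, before row [i] reaches
   the value opposite to that of [x]. It is positive: a row of [W] already there would force that
   value on [x]. *)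
pose slack i : R := if up i then (N *m W) i 0 - k%:R * (beta i - 1)%:~R
  else k%:R * (beta i)%:~R - (N *m W) i 0.
have slackP i : exists2 s : nat, slack i = s%:R & (0 < s)%N.
  have : slack i \is a Num.nat.
    rewrite natrEint /slack /up; have /andP[? ?] := Wk i.
    by case: eqP => _; rewrite subr_ge0 rpredB ?NVint ?rpredM ?rpred_int ?rpred_nat ?intr_int.
  move=> /natrP[s sE]; exists s => //; rewrite lt0n; apply/eqP => s0.
  move: sE; rewrite s0 /slack; case: ifPn => [/eqP xi|/eqP xi] /eqP.
    rewrite subr_eq0 => /eqP /xlo; rewrite xi => /intr_inj; lia.
  by rewrite subr_eq0 eq_sym => /eqP /xup.
pose s i := xget 0%N [set s | slack i = s%:R].
have sE i : slack i = (s i)%:R.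
  by have [s' s'E _] := slackP i; rewrite /s; case: xgetP => [? -> //|/(_ s')].
have s_gt0 i : (0 < s i)%N.
  have [s' s'E s'_gt0] := slackP i.
  by move: s'E; rewrite sE => /eqP; rewrite eqr_nat => /eqP ->.
(* If no slack is below [k], every row of [W] is [k] times that of [x], so [W = k x]. Otherwise the
   row [i1] of least slack blocks first. *)
have [/existsP[i0 si0]|/existsPn large] := boolP [exists i, (s i < k)%N]; last first.
  have sk i : (k <= s i)%N by rewrite leqNgt large.
  have Wx : W = k%:R *: x.
    apply/eqP; rewrite -subr_eq0; apply/eqP/injN; apply/matrixP => i j.
    rewrite ord1 [RHS]mxE mulmxBr -scalemxAr mxE [X in _ + X]mxE [X in - X]mxE.
    have : (k%:R : R) <= slack i by rewrite sE ler_nat.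
    have /andP[lo hi] := Wk i; have := x01 i; rewrite /slack /up.
    case: eqP => [-> _|_ [//|->]]; move: lo hi; rewrite intrB mulr1z; lra.
  exists 1%N, (fun=> x), (fun=> k); split.
  - by move=> a; rewrite big_ord1 => a0 _ i; rewrite ord1.
  - by move=> _; split=> // i; split; [exact: xslab|exact: xup|exact: xlo].
  - by rewrite big_ord1.
  - by rewrite big_ord1.
case: (arg_minnP s (isT : predT i0)) => i1 _ imin.
have rk : (s i1 < k)%N by apply: leq_ltn_trans si0; exact: imin.
pose r := s i1; pose V := W - r%:R *: x.
have NVE i : (N *m V) i 0 = (N *m W) i 0 - r%:R * (N *m x) i 0.
  by rewrite mulmxBr -scalemxAr !mxE.
have rs i : r%:R <= slack i by rewrite sE ler_nat; exact: imin.
have krE : (k - r)%:R = k%:R - r%:R :> R by rewrite natrB// ltnW.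
have r_ge0 : 0 <= r%:R :> R by exact: ler0n.
(* Tight rows of [W] stay tight for [V], so the points given by the induction hypothesis are also
   tight on the tight rows of [W]. *)
have Vup i : (N *m W) i 0 = k%:R * (beta i)%:~R ->
    (N *m V) i 0 = (k - r)%:R * (beta i)%:~R.
  by move=> Wi; rewrite NVE krE (xup _ Wi) Wi; ring.
have Vlo i : (N *m W) i 0 = k%:R * (beta i - 1)%:~R ->
    (N *m V) i 0 = (k - r)%:R * (beta i - 1)%:~R.
  by move=> Wi; rewrite NVE krE (xlo _ Wi) Wi; ring.
have Vk i : (k - r)%:R * (beta i - 1)%:~R <= (N *m V) i 0
    <= (k - r)%:R * (beta i)%:~R.
  have /andP[lo hi] := Wk i; have := rs i; have := x01 i.
  rewrite NVE krE /slack /up; move: lo hi; rewrite intrB mulr1z => lo hi.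
  by case: eqP => [-> _|_ [//|->]] ri; apply/andP; split; lra.
have Vint : integer_vector V.
  by move=> i; rewrite !mxE rpredB ?rpredM ?rpred_nat//; exact: xint.
have Vl : (k - r < l)%N by have := s_gt0 i1; rewrite -/r in rk *; lia.
have [t [xs [c [indep xsP c_sum VE]]]] := IHl _ _ Vl Vint Vk.
exists t.+1, (fun j => oapp xs x (unlift ord0 j)),
  (fun j => oapp c r (unlift ord0 j)); split.
- have row_mulmx (v : 'cV[R]_n) : (row i1 N *m v) 0 0 = (N *m v) i1 0.
    by rewrite -row_mul mxE.
  have ri : slack i1 = r%:R by exact: sE.
  have [xi|xi] := x01 i1; move: ri; rewrite /slack /up xi.
    rewrite eqxx => ri.
    apply: (@affinely_independent_recl _ _ _ _ _ (row i1 N) (beta i1 - 1)%:~R) => //.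
      move=> j; rewrite row_mulmx; have [_ /(_ i1)[_ _ -> //]] := xsP j.
      rewrite NVE krE xi; move: ri; rewrite intrB mulr1z; lra.
    by rewrite row_mulmx xi eqr_int; lia.
  rewrite ifN => [ri|]; last by rewrite eqr_int; lia.
  apply: (@affinely_independent_recl _ _ _ _ _ (row i1 N) (beta i1)%:~R) => //.
    move=> j; rewrite row_mulmx; have [_ /(_ i1)[_ -> //]] := xsP j.
    rewrite NVE krE xi; move: ri; rewrite intrB mulr1z; lra.
  by rewrite row_mulmx xi eqr_int; lia.
- move=> j; case: (unliftP ord0 j) => [j' _|_] /=; last first.
    by split=> // i; split; [exact: xslab|exact: xup|exact: xlo].
  have [xsint xsi] := xsP j'; split=> // i; have [? up' lo'] := xsi i.
  by split=> // [/Vup|/Vlo].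
- rewrite big_ord_recl unlift_none/=.
  by under eq_bigr do rewrite liftK/=; rewrite c_sum subnKC// ltnW.
- rewrite big_ord_recl unlift_none/=.
  by under eq_bigr do rewrite liftK/=; rewrite -VE addrC subrK.
Qed.

(** * Dilates, reflections and box-integrality *)

Lemma dilate_polyhedron (R : realType) (m n : nat) (A : 'M[R]_(m, n))
    (b : 'cV[R]_m) (t : R) :
  0 < t -> dilate t (polyhedron A b) = polyhedron A (t *: b).
Proof.
move=> t0; apply/seteqP; split=> [_ [x Px <-] i|x Px].
  by rewrite -scalemxAr 2!mxE [leRHS]mxE ler_pM2l//; have := Px i; rewrite mxE.
exists (t^-1 *: x); last by rewrite scalerA divff ?gt_eqF// scale1r.
move=> i; rewrite -scalemxAr mxE mulrC ler_pdivrMr// mulrC.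
by have := Px i; rewrite [leRHS]mxE.
Qed.

Lemma reflect_dilateE (R : realType) (n : nat) (w : 'cV[R]_n) (t : R)
    (Q : set 'cV[R]_n) :
  reflect_dilate w t Q = [set x | dilate t Q (w - x)].
Proof.
apply/seteqP; split=> [_ [x Qx <-]|x [y Qy ty]] /=.
  by exists x => //; rewrite opprB addrC subrK.
by exists y => //; rewrite ty opprB addrC subrK.
Qed.

(** Serves the cases [r = 0] and [r = k], where a zero dilate, unlike the cone [A x <= 0], is at
    most the origin, and the intersection lies in the origin or in [w]. *)
Lemma integer_polyhedron_subset1 (R : realType) (n : nat) (Q : set 'cV[R]_n)
    (v : 'cV[R]_n) :
  integer_vector v -> Q `<=` [set v] -> integer_polyhedron Q.
Proof.
move=> vint Qv; split; last first.
  by move=> F [c [delta [_ ->]]] [x [Qx xF]]; exists x => //; rewrite (Qv _ Qx).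
have [Q0|/existsNP[x /contrapT Qx]] := pselect (forall x, ~ Q x).
  (* The empty set is cut out by [0 <= -1]. *)
  exists 1%N, 0, (const_mx (-1)); apply/seteqP; split=> x; first by move/Q0.
  by move=> /(_ 0); rewrite mul0mx !mxE oppr_ge0 ler10.
pose c i := (Num.floor (v i 0))%:E.
suff -> : Q = slab 1%:M c c.
  rewrite slab_polyhedron; do 3!eexists; reflexivity.
have cE i : er_map intr (c i) = (v i 0)%:E by rewrite /= floorK//; exact: vint.
apply/seteqP; split=> [y /Qv -> i|y yv]; first by rewrite mul1mx cE.
suff -> : y = x by [].
rewrite (Qv _ Qx); apply/matrixP => i j; rewrite ord1; apply/eqP.
by have := yv i; rewrite mul1mx cE !lee_fin eq_le => -[-> ->].
Qed.

Lemma totally_unimodular_rational (R : realType) (m n : nat)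
    (A : 'M[R]_(m, n)) (b : 'cV[R]_m) :
  totally_unimodular A -> integer_vector b ->
  is_rational_polyhedron (polyhedron A b).
Proof.
move=> /totally_unimodular_minors/unimodular_minors_int Aint bint.
exists m, (map_mx (fun x => (Num.floor x)%:~R) A),
  (map_mx (fun x => (Num.floor x)%:~R) b).
congr polyhedron; apply/matrixP => i j; rewrite !mxE ratr_int floorK//.
by rewrite ord1; exact: bint.
Qed.

(** For [0 < r < k] the intersection is [A w - (k - r) b <= A x <= r b]; with the box, these are
    integer bounds on the rows of [A] stacked on the identity. *)
Lemma totally_unimodular_calP (R : realType) (m n : nat)
    (A : 'M[R]_(m, n)) (b : 'cV[R]_m) :
  totally_unimodular A -> integer_vector b -> in_calP (polyhedron A b).
Proof.
move=> tuA bint; split; first exact: totally_unimodular_rational.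
move=> k r w rk wint c d _.
have [->|r_gt0] := posnP r.
  apply: (@integer_polyhedron_subset1 _ _ _ 0).
    by move=> i; rewrite mxE rpred0.
  by move=> _ [[[x _ <-] _] _]; rewrite /= scale0r.
have [->|kr_gt0] := posnP (k - r)%N.
  apply: (integer_polyhedron_subset1 wint).
  by move=> _ [[_ [x _ <-]] _]; rewrite /= scale0r subr0.
have tuA' := totally_unimodular_minors tuA.
rewrite reflect_dilateE !dilate_polyhedron ?ltr0n//.
pose c' (i : 'I_(m + n)) := match split i with
  | inl i => (Num.floor ((A *m w) i 0 - (k - r)%:R * b i 0))%:E
  | inr j => c j
  end.
pose d' (i : 'I_(m + n)) := match split i with
  | inl i => (Num.floor (r%:R * b i 0))%:E
  | inr j => d j
  end.
suff -> : polyhedron A (r%:R *: b) `&`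
    [set x | polyhedron A ((k - r)%:R *: b) (w - x)] `&` box c d =
    slab (col_mx A 1%:M) c' d'.
  exact/integer_polyhedron_slab/unimodular_minors_col1.
have c'E i : er_map intr (c' (lshift n i)) =
    ((A *m w) i 0 - (k - r)%:R * b i 0)%:E.
  rewrite /c' (unsplitK (inl i)) /= floorK// rpredB ?rpredM ?rpred_nat//.
  by apply: mulmx_int => [|? ?]; [exact: unimodular_minors_int | rewrite ord1].
have d'E i : er_map intr (d' (lshift n i)) = (r%:R * b i 0)%:E.
  by rewrite /d' (unsplitK (inl i)) /= floorK// rpredM ?rpred_nat//; exact: bint.
have c'E2 i : c' (rshift m i) = c i by rewrite /c' (unsplitK (inr i)).
have d'E2 i : d' (rshift m i) = d i by rewrite /d' (unsplitK (inr i)).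
have NE (x : 'cV[R]_n) : col_mx A 1%:M *m x = col_mx (A *m x) x.
  by rewrite mul_col_mx mul1mx.
have AB (x : 'cV[R]_n) i : (A *m (w - x)) i 0 = (A *m w) i 0 - (A *m x) i 0.
  by rewrite mulmxBr !mxE.
have bZ (t : R) i : (t *: b) i 0 = t * b i 0 by rewrite mxE.
apply/seteqP; split=> [x [[P1 P2] P3] i|x Px].
  rewrite NE; case: (split_ordP i) => j ->.
    rewrite c'E d'E col_mxEu !lee_fin.
    have := P1 j; have := P2 j.
    by rewrite AB !bZ; lra.
  by rewrite c'E2 d'E2 col_mxEd; exact: P3.
split; [split|] => i.
- have [_] := Px (lshift n i); rewrite NE d'E col_mxEu lee_fin.
  by rewrite bZ.
- have [+ _] := Px (lshift n i); rewrite NE c'E col_mxEu lee_fin.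
  by rewrite AB bZ; lra.
- by have := Px (rshift m i); rewrite NE c'E2 d'E2 col_mxEd.
Qed.

(** * The Integer Caratheodory Property of projections *)

(* An integer point [W] of the [k]-th dilate lying over [w] is chosen on a face
   so small that the projection is injective on its affine hull. *)
Lemma totally_unimodular_projection_ICP (R : realType) (m n d : nat)
    (A : 'M[R]_(m, n)) (b : 'cV[R]_m) (f : 'I_d -> 'I_n) :
  totally_unimodular A -> integer_vector b ->
  ICP (projection f (polyhedron A b)).
Proof.
move=> /totally_unimodular_minors tuA bint k w k_gt0 wint [_ [x0 Px0 <-]] x0w.
have tuN := unimodular_minors_col1 tuA.
pose N := col_mx A 1%:M.
have NE (x : 'cV[R]_n) : N *m x = col_mx (A *m x) x.
  by rewrite mul_col_mx mul1mx.
have kR_gt0 : 0 < k%:R :> R by rewrite ltr0n.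
(* Upper bounds valid at [x0]. Those on the coordinates are added so that every row of [N] is
   bounded above and maximal tightness of [W] controls all of [N *m u]. *)
pose beta (i : 'I_(m + n)) := match split i with
  | inl i => Num.floor (b i 0)
  | inr j => Num.ceil (x0 j 0)
  end.
have betaA i : (beta (lshift n i))%:~R = b i 0.
  by rewrite /beta (unsplitK (inl i)) floorK//; exact: bint.
have beta1 j : x0 j 0 <= (beta (rshift m j))%:~R.
  by rewrite /beta (unsplitK (inr j)) ceil_ge.
(* The rows reading a coordinate kept by the projection. Both bounds equal [w'] there, which
   confines [W] to the fibre of [w]; the floor is exact on these rows since [w] is integer. *)
pose fixed (i : 'I_(m + n)) := [exists l, rshift m (f l) == i].
pose w' i := Num.floor (k%:R * (N *m x0) i 0).
pose lo i := if fixed i then (w' i)%:E else -oo%E.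
pose hi i := if fixed i then (w' i)%:E else (k%:Z * beta i)%:E.
have w'E i : fixed i -> (w' i)%:~R = k%:R * (N *m x0) i 0 :> R.
  move=> /existsP[l /eqP <-]; rewrite /w' floorK// NE col_mxEd.
  by have := wint l; rewrite -x0w !mxE.
have Nx0 i : (N *m x0) i 0 <= (beta i)%:~R.
  rewrite NE; case: (split_ordP i) => j ->; last by rewrite col_mxEd.
  by rewrite col_mxEu betaA; exact: Px0.
have kNE i : (N *m (k%:R *: x0)) i 0 = k%:R * (N *m x0) i 0.
  by rewrite -scalemxAr mxE.
have : slab N lo hi (k%:R *: x0).
  move=> i; rewrite kNE /lo /hi; case: ifP => [/w'E w'i|_] /=.
    by rewrite w'i lexx.
  by rewrite leNye lee_fin intrM ler_pM2l.
move=> /(exists_integer_slab_tight tuN)[W [Wint Wslab _ gen]].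
have fixedW i : fixed i -> (N *m W) i 0 = k%:R * (N *m x0) i 0.
  move=> fi; have := Wslab i; rewrite /lo /hi fi /= w'E// !lee_fin => -[? ?].
  by apply/eqP; rewrite eq_le; apply/andP.
have NW i : (N *m W) i 0 <= k%:R * (beta i)%:~R.
  have [fi|fi] := boolP (fixed i); first by rewrite fixedW// ler_pM2l.
  by have [_] := Wslab i; rewrite /hi (negPf fi) /= lee_fin intrM.
(* Rounding [N (W / k)] up gives the unit slab to decompose in. Where [W] attains [k * beta i],
   [beta' i] equals [beta i], so the points found attain [beta i] too. *)
pose beta' i := Num.ceil ((N *m W) i 0 / k%:R).
have beta'_le i : beta' i <= beta i.
  by rewrite /beta' ceil_le_int ler_pdivrMr// mulrC.
have injN (u : 'cV[R]_n) : N *m u = 0 -> u = 0.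
  by rewrite NE -col_mx0 => /eq_col_mx[].
have Wbeta' i : k%:R * (beta' i - 1)%:~R <= (N *m W) i 0 <= k%:R * (beta' i)%:~R.
  rewrite ![k%:R * _]mulrC -(ler_pdivrMr _ _ kR_gt0) -(ler_pdivlMr _ _ kR_gt0) ceil_ge andbT.
  by rewrite ltW// ceilB1_lt.
have [t [x [c [indep xP c_sum WE]]]] := slab_caratheodory tuN injN Wint Wbeta'.
have xtight i j : (N *m W) i 0 = k%:R * (beta i)%:~R ->
    (N *m x j) i 0 = (beta i)%:~R.
  move=> Wi; have [_ /(_ i)[_ + _]] := xP j.
  have -> : beta' i = beta i by rewrite /beta' Wi mulrC mulKf ?gt_eqF// intrKceil.
  by apply.
exists t, (fun j => rowsub f (x j)), c; split=> //.
(* A relation among the projections lifts to [u] with zero kept coordinates. On a row where [W]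
   attains [k * beta i], all [x j] attain [beta i], so [N u] is the sum of [a] times [beta i], which
   is 0. Maximal tightness then gives [N u = 0]. *)
- move=> a a_sum ax_sum; apply: indep => //; apply: injN.
  set u := \sum_(i < t) _.
  have fu : rowsub f u = 0.
    by rewrite -ax_sum linear_sum; apply: eq_bigr => j _; rewrite linearZ.
  have Nu_fixed i : fixed i -> (N *m u) i 0 = 0.
    move=> /existsP[l /eqP <-]; rewrite NE col_mxEd.
    by move/matrixP: fu => /(_ l 0); rewrite !mxE.
  have /gen Nu : forall i z, lo i = z%:E \/ hi i = z%:E ->
      (N *m W) i 0 = z%:~R -> (N *m u) i 0 = 0.
    move=> i z; have [/Nu_fixed//|fi] := boolP (fixed i).
    rewrite /lo /hi (negPf fi) => -[//|[<-]]; rewrite intrM => Wi.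
    rewrite mulmx_sumr summxE.
    under eq_bigr => j _ do rewrite -scalemxAr mxE (xtight _ j Wi).
    by rewrite -mulr_suml a_sum mul0r.
  apply/matrixP => i j; rewrite ord1 [RHS]mxE.
  have [/Nu_fixed//|fi] := boolP (fixed i).
  by apply: (Nu i (k%:Z * beta i)); rewrite /hi (negPf fi).
- move=> j; have [xint xi] := xP j; split; last by move=> l; rewrite mxE.
  exists (x j) => // i; have [/andP[_ up] _ _] := xi (lshift n i).
  move: up; rewrite NE col_mxEu => /le_trans; apply.
  by rewrite -betaA ler_int.
- have -> : w = rowsub f W.
    apply/matrixP => l j; rewrite ord1 -x0w !mxE.
    have /fixedW : fixed (rshift m (f l)) by apply/existsP; exists l.
    by rewrite !NE !col_mxEd.
  by rewrite WE linear_sum; apply: eq_bigr => j _; rewrite linearZ.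
Qed.

Theorem theorem6 (R : realType) (m n : nat) (A : 'M[R]_(m, n)) (b : 'cV[R]_m)
    (hA : totally_unimodular A) (hb : integer_vector b) :
  in_calP (polyhedron A b) /\
  forall (d : nat) (f : 'I_d -> 'I_n), increasing f ->
    ICP (projection f (polyhedron A b)).
Proof.
split; first exact: totally_unimodular_calP.
by move=> d f _; exact: totally_unimodular_projection_ICP.
Qed.
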